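(* For every static constant game $A$, both $\mathbf{R}^L A$ and $\mathbf{C}^L A$ are static games; i.e., the loose toggling-branching recurrence and corecurrence operations are static.
   Context: Games (Computability Logic). A move is a finite string; a labmove is a move prefixed by a label $\top$ (machine) or $\bot$ (environment); a run is a finite or infinite sequence of labmoves, and a position is a finite run. For a player $\wp$, $\neg\wp$ denotes the other player. A (constant) game $A$ consists of a set of legal runs, closed under initial segments, where a run is legal iff all its finite initial segments are legal positions, together with a function assigning to each legal run a winner ($\top$ or $\bot$). An illegal run is $\wp$-illegal iff its shortest illegal initial segment ends with a $\wp$-labeled move; a $\wp$-illegal run is won by $\neg\wp$. The negation $\neg A$ is obtained by interchanging the labels $\top,\bot$ in all runs (legality and winners). A run $\Delta$ is a $\wp$-delay of a run $\Gamma$ iff (i) for each player, the subsequence of that player's labmoves is the same in $\Delta$ and $\Gamma$, and (ii) for all $n,k\geq 1$, if in $\Gamma$ the $n$th $\neg\wp$-labeled move is made later than the $k$th $\wp$-labeled move, then the same holds in $\Delta$. A game $A$ is static iff whenever a run $\Gamma$ is won by $\wp$ and $\Delta$ is a $\wp$-delay of $\Gamma$, $\Delta$ is also won by $\wp$. Notation. For a run $\Omega$ and an infinite bitstring $v$, $\Omega^{\preceq v}$ is obtained from $\Omega$ by deleting all labmoves except those whose move has the form $u.\alpha$ for some finite initial segment $u$ of $v$ (possibly empty), and then deleting the prefix ''$u.$'' from such moves (labels are kept). Loose toggling-branching recurrence $\mathbf{R}^L A$: a run $\Gamma$ is a legal run of $\mathbf{R}^L A$ iff (1) every labmove of $\Gamma$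 is either of the form $\bot w$ (a switch move), with $w$ a finite bitstring, or of the form $\wp w.\alpha$ with $\wp\in\{\top,\bot\}$, $w$ a finite bitstring and $\alpha$ a move; and (2) for every infinite bitstring $v$, $\Gamma^{\preceq v}$ is a legal run of $A$. A legal run $\Gamma$ of $\mathbf{R}^L A$ is won by $\bot$ iff $\Gamma$ contains only finitely many switch moves and $\Gamma^{\preceq t}$ is a $\bot$-won run of $A$, where $t$ is the last switch move of $\Gamma$ with infinitely many $0$s appended (or the infinite string of $0$s if there are no switch moves). The loose toggling-branching corecurrence is $\mathbf{C}^L A=\neg\mathbf{R}^L\neg A$ (the same definition with $\top$ and $\bot$ interchanged).
   Formalization: A ℘-delay is taken in the standard sense (an nth ℘-move later than the kth ¬℘-move stays later), reversing the printed condition (ii); games are also required to give each player some illegal move at every legal position. Without either change the claim is false. *)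

(* Defs.v *)
From Stdlib Require Import Ascii.
From mathcomp Require Import all_boot.
From mathcomp Require Import boolp.

Set Implicit Arguments.
Unset Strict Implicit.
Unset Printing Implicit Defensive.

(** * Finite or infinite sequences *)

Inductive iseq (T : Type) : Type :=
  | Fin of seq T
  | Inf of (nat -> T).

Definition iget T (x : iseq T) (n : nat) : option T :=
  match x with Fin s => onth s n | Inf f => Some (f n) end.

(* For [n] beyond the length of a finite [x], this is all of [x]. *)
Definition iprefix T (n : nat) (x : iseq T) : seq T :=
  match x with Fin s => take n s | Inf f => mkseq f n end.

Definition imap T U (f : T -> U) (x : iseq T) : iseq U :=
  match x with Fin s => Fin (map f s) | Inf g => Inf (fun n => f (g n)) end.

Lemma pmap_mkseqS T U (f : T -> option U) (g : nat -> T) n :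
  pmap f (mkseq g n.+1) =
  pmap f (mkseq g n) ++ (if f (g n) is Some u then [:: u] else [::]).
Proof.
by rewrite /mkseq -addn1 iotaD add0n map_cat pmap_cat /=; case: (f (g n)).
Qed.

Lemma ipmap_subproof T U (f : T -> option U) (g : nat -> T) :
  ~ (exists N, forall n, N <= n -> f (g n) = None) ->
  forall k, exists u, exists n, onth (pmap f (mkseq g n)) k = Some u.
Proof.
move=> often.
have next N : exists2 n, N <= n & exists u, f (g n) = Some u.
  apply: contra_notP often => none; exists N => n leNn.
  by case E: (f (g n)) => [u|//]; case: none; exists n => //; exists u.
have grow k : exists n, k < size (pmap f (mkseq g n)).
  elim: k => [|k [n ltkn]].
    have [n _ [u E]] := next 0.
    by exists n.+1; rewrite pmap_mkseqS E size_cat addn1.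
  have [m lenm [u E]] := next n.
  exists m.+1; rewrite pmap_mkseqS E size_cat addn1 ltnS.
  apply: leq_trans ltkn _.
  by rewrite -(subnKC lenm) /mkseq iotaD map_cat pmap_cat size_cat leq_addr.
move=> k; have [n ltkn] := grow k.
case E: (onth (pmap f (mkseq g n)) k) => [u|]; first by exists u, n.
by move: ltkn; rewrite -onthTE E.
Qed.

(* [pmap] for finite or infinite sequences: delete the items on which [f] is
   undefined, and replace every other item by its image under [f]. *)
Definition ipmap T U (f : T -> option U) (x : iseq T) : iseq U :=
  match x with
  | Fin s => Fin (pmap f s)
  | Inf g =>
      match pselect (exists N, forall n, N <= n -> f (g n) = None) with
      | left h => Fin (pmap f (mkseq g (projT1 (cid h))))
      | right h => Inf (fun k => projT1 (cid (ipmap_subproof h k)))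
      end
  end.

Lemma onth_prefix T (s1 s2 : seq T) k u :
  onth s1 k = Some u -> onth (s1 ++ s2) k = Some u.
Proof.
by move=> E; rewrite onth_cat -onthTE E.
Qed.

Lemma onth_pmap_mono T U (f : T -> option U) (g : nat -> T) m n k u :
  m <= n -> onth (pmap f (mkseq g m)) k = Some u ->
  onth (pmap f (mkseq g n)) k = Some u.
Proof.
move=> /subnKC <- E; rewrite /mkseq iotaD map_cat pmap_cat.
exact: onth_prefix.
Qed.

Lemma ipmapP T U (f : T -> option U) (x : iseq T) k u :
  iget (ipmap f x) k = Some u <->
  exists n, onth (pmap f (iprefix n x)) k = Some u.
Proof.
case: x => [s|g] /=.
  split=> [E|[n]]; first by exists (size s); rewrite take_size.
  by rewrite -{2}(cat_take_drop n s) pmap_cat; apply: onth_prefix.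
case: pselect => [h|h] /=.
  case: cid => N none /=; split=> [E|[n E]]; first by exists N.
  have [leNn|/ltnW leNn] := leqP N n; last exact: onth_pmap_mono E.
  move: E; rewrite -(subnKC leNn) /mkseq iotaD map_cat pmap_cat.
  have tail0 d M : N <= M -> pmap f [seq g i | i <- iota M d] = [::].
    by elim: d M => //= d IHd M leNM; rewrite none //= IHd // leqW.
  by rewrite (tail0 (n - N)) // ?cats0.
case: cid => v [m Em] /=; split=> [[<-]|[n En]]; first by exists m.
have := onth_pmap_mono (leq_maxl m n) Em.
by rewrite (onth_pmap_mono (leq_maxr m n) En) => ->.
Qed.

Lemma iseq_ext T (x y : iseq T) :
  (forall k u, iget x k = Some u <-> iget y k = Some u) -> x = y.
Proof.
move=> exy.
have {}exy k : iget x k = iget y k.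
  case Ex: (iget x k) => [u|]; first by apply/esym/exy.
  by case Ey: (iget y k) => [u|//]; rewrite -Ex; apply/exy.
case: x y exy => [s|f] [t|g] /= exy.
- by congr Fin; apply: eq_from_onth.
- by have := exy (size s); rewrite onth_default.
- by have := exy (size t); rewrite onth_default.
- by congr Inf; apply/funext => k; case: (exy k).
Qed.

Lemma iget_iprefix T (x : iseq T) n k u :
  onth (iprefix n x) k = Some u -> iget x k = Some u.
Proof.
case: x => [s|g] /= E.
  by rewrite -(cat_take_drop n s); apply: onth_prefix.
have := E; rewrite (_ : onth _ k = if k < n then Some (g k) else None).
  by case: ifP.
case: ltnP => [ltkn|lenk]; last by rewrite onth_default ?size_mkseq.
by rewrite onthE (nth_map (g 0)) ?size_mkseq // nth_mkseq.
Qed.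

Lemma onth_iprefix T (x : iseq T) k u :
  iget x k = Some u -> onth (iprefix k.+1 x) k = Some u.
Proof.
case: x => [s|g] /= E.
  have ltks : k < size s by rewrite -onthTE E.
  rewrite -E -{2}(cat_take_drop k.+1 s) onth_cat size_take_min.
  by rewrite leq_min ltnSn ltks.
by rewrite onthE (nth_map (g 0)) ?size_mkseq // nth_mkseq.
Qed.

Lemma iprefix_eq T (x : iseq T) (s : seq T) :
  (forall k u, onth s k = Some u -> iget x k = Some u) ->
  iprefix (size s) x = s.
Proof.
move=> sx; have size_x : size (iprefix (size s) x) = size s.
  case: x sx => [t|g] sx /=; last by rewrite size_mkseq.
  rewrite size_take_min; apply/minn_idPl; case: (posnP (size s)) => [->//|s_gt0].
  rewrite -(prednK s_gt0) -onthTE.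
  case E: (onth s (size s).-1) => [u|]; first by rewrite (sx _ _ E : onth t _ = _).
  by have := onthTE s (size s).-1; rewrite E prednK // leqnn.
apply: eq_from_onth => k; case: (ltnP k (size s)) => [ltks|lesk]; last first.
  by rewrite !onth_default ?size_x.
case E: (onth (iprefix _ x) k) => [u|]; last first.
  by have := onthTE (iprefix (size s) x) k; rewrite E size_x ltks.
case E': (onth s k) => [w|]; last by have := onthTE s k; rewrite E' ltks.
by rewrite -(iget_iprefix E) (sx _ _ E').
Qed.

Lemma pmap_iprefix T U (f : T -> option U) (x : iseq T) n :
  exists k, pmap f (iprefix n x) = iprefix k (ipmap f x).
Proof.
exists (size (pmap f (iprefix n x))).
by rewrite iprefix_eq // => k u E; apply/ipmapP; exists n.
Qed.

Lemma take_pmap T U (f : T -> option U) k (s : seq T) :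
  exists2 n, n <= size s & take k (pmap f s) = pmap f (take n s).
Proof.
elim: s k => [|a s IHs] k; first by exists 0.
case E: (f a) => [u|]; last first.
  by have [n lens En] := IHs k; exists n.+1; rewrite //= E /= En.
case: k => [|k]; first by exists 0; rewrite //= E.
by have [n lens En] := IHs k; exists n.+1; rewrite //= E /= En.
Qed.

Lemma iprefix_ipmap T U (f : T -> option U) (x : iseq T) k :
  exists n, iprefix k (ipmap f x) = pmap f (iprefix n x).
Proof.
have takeE n : exists m, take k (pmap f (iprefix n x)) = pmap f (iprefix m x).
  have [m lem ->] := take_pmap f k (iprefix n x); exists m; congr pmap.
  case: x lem => [s|g] /=; rewrite ?size_mkseq => lem; last first.
    by rewrite /mkseq -map_take take_iota (minn_idPl lem).
  by rewrite take_takel // (leq_trans lem) // size_take_min geq_minl.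
suff [n <-] : exists n, take k (pmap f (iprefix n x)) = iprefix k (ipmap f x).
  exact: takeE.
case Ey: (ipmap f x) => [t|h] /=.
  have [n En] : exists n, t = pmap f (iprefix n x).
    case: (x) Ey => [s|g] /=; first by case=> <-; exists (size s); rewrite take_size.
    by case: pselect => //= e [<-]; exists (projT1 (cid e)).
  by exists n; rewrite -En.
have /ipmapP[n En] : iget (ipmap f x) k = Some (h k) by rewrite Ey.
have ltk : k < size (pmap f (iprefix n x)) by rewrite -onthTE En.
exists n; have size_k : size (take k (pmap f (iprefix n x))) = k.
  by rewrite size_takel // ltnW.
rewrite -[RHS]/(iprefix k (Inf h)) -Ey -{2}size_k iprefix_eq // => i u E.
by apply/ipmapP; exists n; rewrite -(cat_take_drop k (pmap _ _)); apply: onth_prefix.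
Qed.

(** * Games *)

Notation player := bool (only parsing).
Definition Top : player := true.
Definition Bot : player := false.
Notation opp := negb (only parsing).

Definition move := seq ascii.
Definition labmove := (player * move)%type.
Definition run := iseq labmove.

Definition flip_label (lm : labmove) : labmove := (opp lm.1, lm.2).

(* [wn] is used on legal runs only: see [won].
   [lr_foul] is what remains here of the convention of computability logic that
   one distinguished move never occurs in a legal run.  It cannot be dropped.
   In the game whose legal runs are those where no move of [Top] comes after a
   move of [Bot], all won by [Bot], every run is won by [Bot]: that game is
   static.  Its loose recurrence is not, as the run consisting of [Top]'s move
   ".a", [Bot]'s move ".b" and infinitely many switch moves is won by [Top],
   but becomes illegal because of [Top] if the first two moves are swapped. *)
Record game := Game {
  lr : run -> Prop;
  wn : run -> player;
  lrP : forall G, lr G <-> forall n, lr (Fin (iprefix n G));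
  lr_foul : forall s p, lr (Fin s) -> exists a, ~ lr (Fin (rcons s (p, a)))
}.

Definition illegal_by (A : game) (p : player) (G : run) : Prop :=
  exists n, [/\ ~ lr A (Fin (iprefix n G)),
    forall m, m < n -> lr A (Fin (iprefix m G)) &
    exists s a, iprefix n G = rcons s (p, a)].

Definition won (A : game) (p : player) (G : run) : Prop :=
  (lr A G /\ wn A G = p) \/ illegal_by A (opp p) G.

Definition moves_of (p : player) (G : run) : iseq labmove :=
  ipmap (fun lm => if lm.1 == p then Some lm else None) G.

(* The [n]th (counting from 1) [p]-labeled move of [G] stands at index [i]. *)
Definition nth_move_at (p : player) (n : nat) (G : run) (i : nat) : Prop :=
  (exists a, iget G i = Some (p, a)) /\
  count (fun lm => lm.1 == p) (iprefix i.+1 G) = n.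

(* The [n]th [p]-labeled move of [G] is later than the [k]th [q]-labeled one. *)
Definition later (G : run) (p : player) (n : nat) (q : player) (k : nat) : Prop :=
  exists i j, [/\ nth_move_at p n G i, nth_move_at q k G j & j < i].

(* [D] postpones moves of [p]: a move of [p] made after a move of [opp p]
   in [G] is still after it in [D].  With [p] and [opp p] exchanged here, it is
   the adversary of [p] that is slowed down, and no [game] with a legal run
   is static, because of the order of two moves that are illegal for the
   respective players. *)
Definition delay (p : player) (D G : run) : Prop :=
  (forall q, moves_of q D = moves_of q G) /\
  (forall n k, 1 <= n -> 1 <= k ->
     later G p n (opp p) k -> later D p n (opp p) k).

Definition static (A : game) : Prop :=
  forall p G D, won A p G -> delay p D G -> won A p D.

(** * Negation *)

Lemma iprefix_imap T U (f : T -> U) n (x : iseq T) :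
  iprefix n (imap f x) = map f (iprefix n x).
Proof.
by case: x => [s|g] /=; rewrite ?map_take // /mkseq -map_comp.
Qed.

Lemma neg_lrP (A : game) G :
  lr A (imap flip_label G) <->
  forall n, lr A (imap flip_label (Fin (iprefix n G))).
Proof.
by rewrite lrP; split=> H n; have := H n; rewrite /= iprefix_imap.
Qed.

Lemma neg_foul (A : game) s p :
  lr A (imap flip_label (Fin s)) ->
  exists a, ~ lr A (imap flip_label (Fin (rcons s (p, a)))).
Proof.
by move=> /(lr_foul (opp p)) [a Ha]; exists a; rewrite /= map_rcons.
Qed.

Definition neg (A : game) : game :=
  {| lr := fun G => lr A (imap flip_label G);
     wn := fun G => opp (wn A (imap flip_label G));
     lrP := @neg_lrP A;
     lr_foul := @neg_foul A |}.

(** * Loose toggling-branching recurrence and corecurrence *)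

(* The character of code 46, a full stop. *)
Definition dot : ascii := "046"%char.
Definition bit (b : bool) : ascii := if b then "1"%char else "0"%char.
Definition bits (w : seq bool) : move := map bit w.

Fixpoint unbits (m : move) : option (seq bool) :=
  if m is c :: m' then
    if Ascii.eqb c (bit false) then omap (cons false) (unbits m')
    else if Ascii.eqb c (bit true) then omap (cons true) (unbits m')
    else None
  else Some [::].

Lemma unbitsP m w : unbits m = Some w <-> m = bits w.
Proof.
split=> [|->]; last by elim: w => [|[] w IHw] //=; rewrite IHw.
elim: m w => [|c m IHm] w /=; first by case=> <-.
case: Ascii.eqb_spec => [->|_].
  by case E: (unbits m) => [w'|//] [<-] /=; rewrite (IHm w').
case: Ascii.eqb_spec => [->|//].
by case E: (unbits m) => [w'|//] [<-] /=; rewrite (IHm w').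
Qed.

Fixpoint strip (v : nat -> bool) (m : move) : option move :=
  if m is c :: m' then
    if Ascii.eqb c dot then Some m'
    else if Ascii.eqb c (bit (v 0)) then strip (fun n => v n.+1) m'
    else None
  else None.

Lemma stripP v m a :
  strip v m = Some a <-> exists n, m = bits (mkseq v n) ++ dot :: a.
Proof.
split=> [|[n ->]].
  elim: m v => [|c m IHm] v //=.
  case: Ascii.eqb_spec => [-> [<-]|_]; first by exists 0.
  case: Ascii.eqb_spec => [->|//] /IHm[n ->]; exists n.+1.
  by rewrite /mkseq /= -[1]addn0 iotaDl -map_comp.
elim: n v => [|n IHn] v //=.
rewrite -[1]addn0 iotaDl -map_comp -/(bits _) /=.
have -> : Ascii.eqb (bit (v 0)) dot = false by case: (v 0).
by rewrite Ascii.eqb_refl; apply: (IHn (fun n => v n.+1)).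
Qed.

(* The items of [G] of the form "u.a", with u an initial segment of [v], taken
   without that prefix. *)
Definition branch (v : nat -> bool) (G : run) : run :=
  ipmap (fun lm => omap (pair lm.1) (strip v lm.2)) G.

Definition switches (G : run) : iseq (seq bool) :=
  ipmap (fun lm => if lm.1 == Bot then unbits lm.2 else None) G.

Definition pad0 (w : seq bool) : nat -> bool := nth false w.

Definition RL_labmove (lm : labmove) : Prop :=
  (exists w, lm = (Bot, bits w)) \/
  (exists p w a, lm = (p, bits w ++ dot :: a)).

Definition RL_lr (A : game) (G : run) : Prop :=
  (forall i lm, iget G i = Some lm -> RL_labmove lm) /\
  (forall v, lr A (branch v G)).

(* The default of [last] serves the case without switch moves: [pad0 [::]] is
   the constantly 0 bitstring. *)
Definition RL_bot_won (A : game) (G : run) : Prop :=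
  match switches G with
  | Fin ws => won A Bot (branch (pad0 (last [::] ws)) G)
  | Inf _ => False
  end.

Lemma RL_lrP (A : game) G :
  RL_lr A G <-> forall n, RL_lr A (Fin (iprefix n G)).
Proof.
split=> [[formG legG] n|leg]; split.
- by move=> i lm E; apply: (formG i); apply: iget_iprefix E.
- move=> v; have [k Ek] :=
    pmap_iprefix (fun lm => omap (pair lm.1) (strip v lm.2)) G n.
  by rewrite /branch /= Ek; apply: (proj1 (lrP _ _) (legG v)).
- move=> i lm E; have [formG _] := leg i.+1.
  by apply: (formG i); apply: onth_iprefix E.
- move=> v; apply/lrP => k; rewrite /branch.
  have [n ->] := iprefix_ipmap (fun lm => omap (pair lm.1) (strip v lm.2)) G k.
  exact: (proj2 (leg n) v).
Qed.

Lemma RL_foul (A : game) s p :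
  RL_lr A (Fin s) -> exists a, ~ RL_lr A (Fin (rcons s (p, a))).
Proof.
move=> _; exists [:: "2"%char] => -[form _].
have last_s : iget (Fin (rcons s (p, [:: "2"%char]))) (size s)
              = Some (p, [:: "2"%char]).
  by rewrite /= -cats1 onth_cat ltnn subnn.
by case: (form _ _ last_s) => [[[|[] w]]|[q [[|[] w] [a]]]].
Qed.

Definition RL (A : game) : game :=
  {| lr := RL_lr A;
     wn := fun G => if `[< RL_bot_won A G >] then Bot else Top;
     lrP := @RL_lrP A;
     lr_foul := @RL_foul A |}.

Definition CL (A : game) : game := neg (RL (neg A)).

(* Main.v *)
Require Import Defs.
From mathcomp Require Import all_boot.
From mathcomp Require Import boolp.

(** A delay of a run restricts to a delay on each of its branches, so the
    winners of the legal runs are taken care of by the staticness of [A].  The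
    point is legality: in a static game, an offence of [p] in a [p]-delay of
    [G] comes from an offence of [p] in [G] itself.  This holds for [RL A]
    because its offences are malformed moves and offences in branches, and
    because the first offences of the two players in [G] and in its delay
    cannot be in opposite orders.  [CL A] follows by exchanging the players. *)

Set Implicit Arguments.
Unset Strict Implicit.
Unset Printing Implicit Defensive.

(** * Prefixes and partial maps of finite or infinite sequences *)

Lemma iprefix_le T (x : iseq T) m n :
  m <= n -> exists u, iprefix n x = iprefix m x ++ u.
Proof.
case: x => [s|g] lemn /=.
  by exists (drop m (take n s)); rewrite -{1}(cat_take_drop m (take n s)) take_takel.
by exists (map g (iota m (n - m))); rewrite -{1}(subnKC lemn) /mkseq iotaD map_cat.
Qed.

Lemma iprefixS T (x : iseq T) i u :
  iget x i = Some u -> iprefix i.+1 x = rcons (iprefix i x) u.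
Proof.
case: x => [s|g] /= E; last by case: E => <-; rewrite /mkseq -addn1 iotaD map_cat cats1.
have lti : i < size s by rewrite -onthTE E.
by rewrite (take_nth u lti); congr rcons; apply: onth_nth.
Qed.

Lemma iprefixS_None T (x : iseq T) i :
  iget x i = None -> iprefix i.+1 x = iprefix i x.
Proof.
case: x => [s|g] //= E.
have lesi : size s <= i by rewrite leqNgt -onthTE E.
by rewrite !take_oversize // ltnW.
Qed.

Lemma count_iprefix_le T (a : pred T) (x : iseq T) m n :
  m <= n -> count a (iprefix m x) <= count a (iprefix n x).
Proof. by move=> /(iprefix_le x) [u ->]; rewrite count_cat leq_addr. Qed.

Lemma iprefix_initial T (x : iseq T) n s u :
  iprefix n x = s ++ u -> iprefix (size s) x = s.
Proof.
move=> E; apply: iprefix_eq => k w Ek.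
by apply: (@iget_iprefix _ _ n); rewrite E; apply: onth_prefix.
Qed.

Lemma iprefix_iprefix T (x : iseq T) m n :
  exists k, take m (iprefix n x) = iprefix k x.
Proof.
exists (size (take m (iprefix n x))).
by rewrite (@iprefix_initial _ _ n _ (drop m (iprefix n x))) // cat_take_drop.
Qed.

Lemma pmap_comp T U V (f : U -> option V) (g : T -> option U) s :
  pmap f (pmap g s) = pmap (fun x => obind f (g x)) s.
Proof. by elim: s => //= a s <-; case: (g a). Qed.

Lemma ipmap_comp T U V (f : U -> option V) (g : T -> option U) x :
  ipmap f (ipmap g x) = ipmap (fun a => obind f (g a)) x.
Proof.
apply: iseq_ext => k u; split=> /ipmapP [n E]; apply/ipmapP.
  have [m Em] := iprefix_ipmap g x n.
  by exists m; rewrite -pmap_comp -Em.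
have [m Em] := pmap_iprefix g x n.
by exists m; rewrite -Em pmap_comp.
Qed.

Lemma imap_ipmap T U (f : T -> U) x : imap f x = ipmap (fun a => Some (f a)) x.
Proof.
have pmapE s : pmap (fun a => Some (f a)) s = map f s by elim: s => //= a s ->.
apply: iseq_ext => k u; split=> [E|/ipmapP [n]].
  by apply/ipmapP; exists k.+1; rewrite pmapE -iprefix_imap (onth_iprefix E).
by rewrite pmapE -iprefix_imap; apply: iget_iprefix.
Qed.

(** * Moves of one player, and delays in terms of counts *)

Definition owned (p : player) : pred labmove := fun lm => lm.1 == p.

Lemma pmap_owned p s :
  pmap (fun lm : labmove => if lm.1 == p then Some lm else None) s =
  filter (owned p) s.
Proof. by elim: s => //= lm s ->; rewrite /owned; case: ifP. Qed.

Lemma moves_of_Fin p s : moves_of p (Fin s) = Fin (filter (owned p) s).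
Proof. by rewrite /moves_of /= pmap_owned. Qed.

Lemma moves_of_filter p D G m :
  moves_of p D = moves_of p G ->
  exists n, filter (owned p) (iprefix n G) = filter (owned p) (iprefix m D).
Proof.
move=> E; rewrite -pmap_owned.
have [k ->] := pmap_iprefix (fun lm => if lm.1 == p then Some lm else None) D m.
rewrite -/(moves_of p D) E.
have [n ->] := iprefix_ipmap (fun lm => if lm.1 == p then Some lm else None) G k.
by exists n; rewrite pmap_owned.
Qed.

(** Both filtered prefixes are initial segments of one and the same sequence, so comparing their
    lengths is enough. *)
Lemma moves_of_initial p D G m n :
  moves_of p D = moves_of p G ->
  count (owned p) (iprefix m D) <= count (owned p) (iprefix n G) ->
  exists u, filter (owned p) (iprefix n G) = filter (owned p) (iprefix m D) ++ u.
Proof.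
move=> E; have [k Ek] := moves_of_filter m E.
rewrite -!size_filter -Ek.
have [lekn|/ltnW lenk] := leqP k n.
  by have [u ->] := iprefix_le G lekn; rewrite filter_cat; eexists.
have [u ->] := iprefix_le G lenk; rewrite filter_cat size_cat => le_u.
exists [::]; move: le_u; rewrite -[leqRHS]addn0 leq_add2l leqn0.
by move=> /eqP /size0nil ->; rewrite !cats0.
Qed.

Lemma nth_move_at_exists p n G m :
  0 < n <= count (owned p) (iprefix m G) -> exists i, nth_move_at p n G i.
Proof.
case/andP=> n_gt0; elim: m => [|m IHm].
  by case: G => [s|g]; rewrite /= ?take0 leqNgt n_gt0.
case Em: (iget G m) => [[q a]|]; last by rewrite iprefixS_None.
rewrite (iprefixS Em) -cats1 count_cat /= addn0 [owned p _]/owned /=.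
case: eqP => [Eq|_] /=; last by rewrite addn0.
rewrite addn1 leq_eqVlt ltnS => /orP [/eqP En|//].
exists m; split; first by exists a; rewrite Em Eq.
by rewrite (iprefixS Em) -cats1 count_cat /= addn0 Eq eqxx addn1 En.
Qed.

Lemma nth_move_at_count p n G i :
  nth_move_at p n G i ->
  [/\ count (owned p) (iprefix i.+1 G) = n,
      n = (count (owned p) (iprefix i G)).+1 &
      count (owned (opp p)) (iprefix i.+1 G) =
      count (owned (opp p)) (iprefix i G)].
Proof.
case=> -[a Ei] En; split=> //; rewrite -?En (iprefixS Ei) -cats1 count_cat /=.
  by rewrite eqxx addn1.
by rewrite /owned /=; case: (p); rewrite !addn0.
Qed.

(* Follow a run in the plane whose coordinates count the moves of [p] and of
   [opp p]: [D] is a [p]-delay of [G] when the path of [D] never gets to the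
   [p]-side of the path of [G]. *)
Definition uncrossed (p : player) (D G : run) : Prop := forall m n,
  count (owned p) (iprefix m D) <= count (owned p) (iprefix n G) \/
  count (owned (opp p)) (iprefix n G) <= count (owned (opp p)) (iprefix m D).

Lemma delayP p D G :
  delay p D G <-> (forall q, moves_of q D = moves_of q G) /\ uncrossed p D G.
Proof.
split=> -[movesE unc]; split=> //.
  move=> m n; case: leqP => ltp; [by left | right].
  rewrite leqNgt; apply/negP => lto.
  have [m' /(congr1 size)] := moves_of_filter m (movesE p).
  rewrite !size_filter => Em'.
  (* Take the last move of [p] among the first [m] items of [D] and the last move of [opp p] among
     the first [n] items of [G]. In [G] the former is later, in [D] it is earlier. *)
  have [|i0 /[dup] Gi0 /nth_move_at_count [Ci0 _ _]] :=
    @nth_move_at_exists p (count (owned p) (iprefix m D)) G m'.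
    by rewrite Em' leqnn (leq_ltn_trans _ ltp).
  have [|j /[dup] Gj /nth_move_at_count [Cj Cj' _]] :=
    @nth_move_at_exists (opp p) (count (owned (opp p)) (iprefix n G)) G n.
    by rewrite leqnn (leq_ltn_trans _ lto).
  have ltjn : j < n.
    rewrite ltnNge; apply/negP => lenj.
    by have := count_iprefix_le (owned (opp p)) G lenj; rewrite Cj' ltnn.
  have leni0 : n <= i0.
    rewrite leqNgt; apply/negP => lti0.
    have := count_iprefix_le (owned p) G lti0.
    by rewrite Ci0 leqNgt ltp.
  case: (unc _ _ _ _ (ex_intro _ i0 (ex_intro _ j (And3 Gi0 Gj (leq_trans ltjn leni0))))).
  - by rewrite (leq_ltn_trans _ ltp).
  - by rewrite (leq_ltn_trans _ lto).
  move=> i [j' [/nth_move_at_count [_ Ci _] /nth_move_at_count [Cj1 _ _] ltji]].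
  have lemi : i < m.
    rewrite ltnNge; apply/negP => lemi.
    by have := count_iprefix_le (owned p) D lemi; rewrite Ci ltnn.
  have := count_iprefix_le (owned (opp p)) D (leq_trans ltji (ltnW lemi)).
  by rewrite Cj1 leqNgt lto.
move=> n k n_gt0 k_gt0 [i [j [Gi Gj ltji]]].
have [Ci Ci' _] := nth_move_at_count Gi; have [Cj _ _] := nth_move_at_count Gj.
have inD q l h : 0 < l -> nth_move_at q l G h -> exists h', nth_move_at q l D h'.
  move=> l_gt0 [_ Cl].
  have [m /(congr1 size)] := moves_of_filter h.+1 (esym (movesE q)).
  rewrite !size_filter => Em.
  by apply: (@nth_move_at_exists _ _ _ m); rewrite l_gt0 Em /owned Cl leqnn.
have [i' Di'] := inD _ _ _ n_gt0 Gi; have [j' Dj'] := inD _ _ _ k_gt0 Gj.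
exists i', j'; split=> //; rewrite ltnNge; apply/negP => leij.
have [Di1 _ Di2] := nth_move_at_count Di'; have [_ Dj2 _] := nth_move_at_count Dj'.
(* These two prefixes would cross: the one of [D] has [n] moves of [p] and fewer than [k] of
   [opp p], the one of [G] has fewer than [n] of [p] and [k] of [opp p]. *)
case: (unc i'.+1 j.+1); rewrite ?Di1 ?Di2 ?Cj ?Ci'.
  by rewrite leqNgt ltnS count_iprefix_le.
by rewrite Dj2 leqNgt ltnS count_iprefix_le.
Qed.

(** The two alternatives of [uncrossed] trade places when both the runs and the players are
    exchanged. *)
Lemma delay_sym p D G : delay p D G -> delay (opp p) G D.
Proof.
move=> /delayP [movesE unc]; apply/delayP; split=> [q|m n]; first by rewrite movesE.
by rewrite negbK; case: (unc n m); [right | left].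
Qed.

(** * Delays under partial maps of labmoves *)

Section RelabelingMaps.

(** The bit [c] tells whether [f] exchanges the players: [false] serves branches, [true] serves
    [flip_label]. *)
Variables (c : bool) (f : labmove -> option labmove).
Hypothesis label_f : forall lm u, f lm = Some u -> u.1 = lm.1 (+) c.

Lemma moves_of_ipmap q G : moves_of q (ipmap f G) = ipmap f (moves_of (q (+) c) G).
Proof.
rewrite /moves_of !ipmap_comp; congr ipmap; apply/funext => lm.
case E: (f lm) => [u|] /=; last by case: ifP => //= _; rewrite E.
by rewrite (label_f E); case: lm E => -[] a E; case: (c); case: (q) => //=; rewrite E.
Qed.

Lemma count_pmap_owned q s :
  count (owned q) (pmap f s) = size (pmap f (filter (owned (q (+) c)) s)).
Proof.
elim: s => //= lm s IHs; rewrite [owned (q (+) c) lm]/owned.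
case E: (f lm) => [u|] /=; rewrite IHs; last by case: ifP => //= _; rewrite E.
rewrite /owned (label_f E).
by case: lm E => -[] a E; case: (c); case: (q) => //=; rewrite E.
Qed.

(** An inequality between counts of one player's moves is really an inclusion of initial segments,
    and [f] preserves inclusions. *)
Lemma delay_ipmap p D G : delay p D G -> delay (p (+) c) (ipmap f D) (ipmap f G).
Proof.
move=> /delayP [movesE unc]; apply/delayP; split=> [q|m n].
  by rewrite !moves_of_ipmap movesE.
have [m' ->] := iprefix_ipmap f D m; have [n' ->] := iprefix_ipmap f G n.
rewrite !count_pmap_owned addNb addbK.
case: (unc m' n') => [le|le]; [left | right].
  have [u ->] := moves_of_initial (movesE p) le.
  by rewrite pmap_cat size_cat leq_addr.
have [u ->] := moves_of_initial (esym (movesE (opp p))) le.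
by rewrite pmap_cat size_cat leq_addr.
Qed.

End RelabelingMaps.

Lemma delay_branch v p D G : delay p D G -> delay p (branch v D) (branch v G).
Proof.
rewrite -{2}[p]addbF; apply: delay_ipmap => lm u.
by case: strip => //= a [<-]; rewrite addbF.
Qed.

Lemma delay_flip p D G :
  delay p D G -> delay (opp p) (imap flip_label D) (imap flip_label G).
Proof.
rewrite !imap_ipmap -addbT; apply: delay_ipmap => lm u [<-].
by rewrite addbT.
Qed.

Lemma switches_moves_of D G :
  moves_of Bot D = moves_of Bot G -> switches D = switches G.
Proof.
suff switchesE R : switches R = ipmap (fun lm => unbits lm.2) (moves_of Bot R).
  by move=> E; rewrite !switchesE E.
by rewrite ipmap_comp; congr ipmap; apply/funext => lm; case: ifP.
Qed.

(** * Cutting and extending delays *)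

Lemma filter_owned_opp p s : all (owned (opp p)) s -> filter (owned p) s = [::].
Proof.
elim: s => //= -[q a] s IHs /andP[/eqP /= -> /IHs ->].
by rewrite /owned /=; case: (p).
Qed.

Lemma last_owned p s x s' : filter (owned p) s = rcons s' x ->
  exists s1 s2, s = rcons s1 x ++ s2 /\ all (owned (opp p)) s2.
Proof.
elim/last_ind: s s' x => [|s y IHs] s' x; first by case: s'.
rewrite filter_rcons; case: ifP => [_ /rcons_inj [_ <-]|Ny /IHs].
  by exists s, [::]; rewrite cats0.
move=> [s1 [s2 [-> all2]]]; exists s1, (rcons s2 y).
rewrite rcons_cat all_rcons all2 andbT; split=> //.
by move: Ny; rewrite /owned; case: (y.1); case: (p).
Qed.

(* When [p] postpones moves in [D], the prefix of [G] up to the same move of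
   [p] contains at most as many moves of the adversary: [t] supplies the
   missing ones. *)
Lemma delay_cut p D G n s a :
  delay p D G -> iprefix n D = rcons s (p, a) ->
  exists th t, [/\ exists k, iprefix k G = rcons th (p, a),
    all (owned (opp p)) t &
    delay p (Fin (rcons s (p, a))) (Fin (rcons th (p, a) ++ t))].
Proof.
move=> /delayP [movesE unc] En; set x := (p, a); set sx := rcons s x in En *.
have px : owned p x by rewrite /owned eqxx.
have Nx : owned (opp p) x = false by rewrite /owned /=; case: (p).
have [m Em] := moves_of_filter n (movesE p).
have [th [t' [Eth all_t']]] : exists th t',
    iprefix m G = rcons th x ++ t' /\ all (owned (opp p)) t'.
  by apply: (@last_owned _ _ _ (filter (owned p) s)); rewrite Em En filter_rcons px.
have fp : filter (owned p) (rcons th x) = filter (owned p) sx.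
  by rewrite -En -Em Eth filter_cat (filter_owned_opp all_t') cats0.
have Gthx := iprefix_initial Eth; have Gth : iprefix (size th) G = th.
  by apply: (@iprefix_initial _ _ (size (rcons th x)) _ [:: x]); rewrite Gthx cats1.
(* Otherwise [uncrossed] would put as many moves of [p] in [th] as in [sx], but [th] lacks [x]. *)
have le_o : count (owned (opp p)) th <= count (owned (opp p)) sx.
  have := unc n (size th); rewrite Gth En; case=> // le_p.
  move/(congr1 size): fp; rewrite !size_filter => fp.
  by move: le_p; rewrite -fp -cats1 count_cat /= px addn1 ltnn.
have [t Et] : exists t, filter (owned (opp p)) sx =
    filter (owned (opp p)) (rcons th x) ++ t.
  rewrite [filter _ (rcons th x)]filter_rcons Nx -Gth -En.
  by apply: moves_of_initial => //; rewrite Gth En.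
have all_t : all (owned (opp p)) t.
  have := filter_all (owned (opp p)) sx.
  by rewrite Et all_cat => /andP[].
exists th, t; split=> //; first by exists (size (rcons th x)).
apply/delayP; split=> [q|i j].
  rewrite !moves_of_Fin filter_cat; congr Fin.
  have [->|Nq] := eqVneq q p; first by rewrite fp (filter_owned_opp all_t) cats0.
  have -> : q = opp p by move: Nq; case: (q); case: (p).
  by rewrite Et; congr (_ ++ _); apply/esym/all_filterP.
rewrite /= -/sx take_cat; case: ltnP => [ltj|lej].
  have [i' Ei'] := iprefix_iprefix D i n.
  have [j' Ej'] := iprefix_iprefix G j (size (rcons th x)).
  by move: (unc i' j'); rewrite -Ei' -Ej' En Gthx.
left; rewrite count_cat -[count _ (rcons th x)]size_filter fp.
apply: leq_trans (leq_addr _ _); rewrite size_filter.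
by rewrite -{2}(cat_take_drop i sx) count_cat leq_addr.
Qed.

(** A prefix that reaches the new last move contains all moves of both players, which settles one
    alternative of [uncrossed]. *)
Lemma delay_rcons p s t a :
  delay p (Fin s) (Fin t) ->
  delay p (Fin (rcons s (opp p, a))) (Fin (rcons t (opp p, a))).
Proof.
move=> /delayP [movesE unc]; set x := (_, a).
have fE q : filter (owned q) s = filter (owned q) t.
  by have := movesE q; rewrite !moves_of_Fin => -[].
have fxE q : filter (owned q) (rcons s x) = filter (owned q) (rcons t x).
  by rewrite !filter_rcons fE.
have cE q : count (owned q) (rcons s x) = count (owned q) (rcons t x).
  by rewrite -!size_filter fxE.
have take_le q i u : count (owned q) (take i u) <= count (owned q) u.
  by rewrite -{2}(cat_take_drop i u) count_cat leq_addr.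
have take_x i u : i <= size u -> take i (rcons u x) = take i u.
  by move=> lei; rewrite -cats1 takel_cat.
apply/delayP; split=> [q|i j]; first by rewrite !moves_of_Fin fxE.
have [lei|lti] := leqP i (size s); last first.
  by right; rewrite /= [in leqRHS]take_oversize ?size_rcons // cE take_le.
have [lej|ltj] := leqP j (size t); last first.
  by left; rewrite /= [in leqRHS]take_oversize ?size_rcons // -cE take_le.
by have := unc i j; rewrite /= !take_x.
Qed.

(** * Offences, and how delays of static games transfer them *)

Lemma lr_initial (A : game) G n s u :
  lr A G -> iprefix n G = s ++ u -> lr A (Fin s).
Proof. by move=> /lrP legG /iprefix_initial <-. Qed.

Lemma illegal_byP (A : game) p G :
  illegal_by A p G <-> exists n s a,
    [/\ iprefix n G = rcons s (p, a), lr A (Fin s) & ~ lr A (Fin (rcons s (p, a)))].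
Proof.
split=> [[n [ill min [s [a E]]]]|[n [s [a [E leg_s ill]]]]].
  exists n, s, a; rewrite -E; split=> //.
  have Es : iprefix n G = s ++ [:: (p, a)] by rewrite cats1.
  have Es' := iprefix_initial Es; rewrite -Es'; apply: min.
  rewrite ltnNge; apply/negP => /(iprefix_le G) [u].
  rewrite Es' E => /(congr1 size)/eqP.
  by rewrite size_cat size_rcons ltn_eqF // ltnS leq_addr.
have En : iprefix (size (rcons s (p, a))) G = rcons s (p, a).
  by apply: (@iprefix_initial _ _ n _ [::]); rewrite cats0.
exists (size (rcons s (p, a))); rewrite En; split=> //; last by exists s, a.
move=> m; rewrite size_rcons ltnS => lem.
have Es : iprefix (size s) G = s.
  by apply: (@iprefix_initial _ _ n _ [:: (p, a)]); rewrite cats1.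
have [u] := iprefix_le G lem; rewrite Es => Es'.
apply: (lr_initial leg_s (n := size s) (u := u)).
by rewrite /= take_size.
Qed.

Lemma illegal_by_not_lr (A : game) p G : illegal_by A p G -> ~ lr A G.
Proof. by case=> n [ill _ _] /lrP. Qed.

Lemma not_lr_illegal_by (A : game) G :
  lr A (Fin [::]) -> ~ lr A G -> exists p, illegal_by A p G.
Proof.
move=> leg0 ill.
have {}ill : exists n, ~ lr A (Fin (iprefix n G)).
  by apply: contra_notP ill => /forallNP leg; apply/lrP => n; apply: contrapT.
have [n illn] := ill; elim: n illn => [|n IHn] illn.
  by case: illn; case: (G) => [s|g]; rewrite /= ?take0.
have [leg|] := pselect (lr A (Fin (iprefix n G))); last exact: IHn.
case E: (iget G n) => [[p a]|]; last by rewrite iprefixS_None in illn.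
exists p; apply/illegal_byP; exists n.+1, (iprefix n G), a.
by rewrite -(iprefixS E).
Qed.

Lemma illegal_by_inj (A : game) p q G :
  illegal_by A p G -> illegal_by A q G -> p = q.
Proof.
move=> [m [illm minm [s [a Es]]]] [n [illn minn [t [b Et]]]].
case: (ltngtP m n) => [/minn //|/minm //|Emn].
by move: Es; rewrite Emn Et => /rcons_inj [_ ->].
Qed.

(** The offending move belongs to [p], so it cannot lie in [t]. *)
Lemma illegal_by_Fin_cat (A : game) p s t G n :
  iprefix n G = s -> all (owned (opp p)) t ->
  illegal_by A p (Fin (s ++ t)) -> illegal_by A p G.
Proof.
move=> En all_t /illegal_byP [m [u [a [E leg ill]]]]; apply/illegal_byP.
have [lems|ltsm] := leqP m (size s).
  move: E; rewrite /= takel_cat // -En => E.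
  have [k Ek] := iprefix_iprefix G m n.
  by exists k, u, a; rewrite -Ek.
have : all (owned (opp p)) (take (m - size s) t).
  by move: all_t; rewrite -{1}(cat_take_drop (m - size s) t) all_cat => /andP[].
move: E; rewrite /= take_cat ltnNge ltnW //=.
case: (lastP (take _ t)) => [|t' y].
  by rewrite cats0 => E _; exists n, u, a; rewrite En.
rewrite -rcons_cat all_rcons => /rcons_inj [_ Ey] /andP[oy _].
by move: oy; rewrite Ey /owned /=; case: (p).
Qed.

Lemma illegal_by_rcons_cat (A : game) p s a t :
  lr A (Fin s) -> ~ lr A (Fin (rcons s (p, a))) ->
  illegal_by A p (Fin (rcons s (p, a) ++ t)).
Proof.
move=> leg ill; apply/illegal_byP; exists (size (rcons s (p, a))), s, a.
by rewrite /= take_size_cat.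
Qed.

(* If the offence of [p] in [D] had no counterpart in [G], then, after a
   suitable reordering, the adversary could append a foul move to both runs:
   it would lose the first one but not the second one. *)
Lemma illegal_by_delay (A : game) p D G :
  static A -> delay p D G -> illegal_by A p D -> illegal_by A p G.
Proof.
move=> hA del /illegal_byP [n [s [a [En leg ill]]]].
have [th [t [[k Ek] all_t del1]]] := delay_cut del En.
apply: (illegal_by_Fin_cat Ek all_t).
(* The left-hand run is won by [opp p], and [r] is an [opp p]-delay of it. *)
have wonG u r : delay p (Fin (rcons s (p, a) ++ u)) r -> won A (opp p) r.
  move/delay_sym; apply: hA; right; rewrite negbK.
  exact: illegal_by_rcons_cat.
have /wonG : delay p (Fin (rcons s (p, a) ++ [::])) (Fin (rcons th (p, a) ++ t)).
  by rewrite cats0.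
case=> [[leg1 _]|]; last by rewrite negbK.
have [b ill1] := lr_foul (opp p) leg1.
(* With [b] appended, the reordered run is won by [opp p] although [opp p] is its offender. *)
have := delay_rcons b del1; rewrite -{1}cats1 => /wonG [[/ill1 //]|].
rewrite negbK => ill2.
have := illegal_by_rcons_cat [::] leg1 ill1; rewrite cats0.
by move/(illegal_by_inj ill2); case: (p).
Qed.

(** * Staticness of the recurrence *)

Definition in_branch (v : nat -> bool) (lm : labmove) : option labmove :=
  omap (pair lm.1) (strip v lm.2).

Lemma branch_Fin v s : branch v (Fin s) = Fin (pmap (in_branch v) s).
Proof. by []. Qed.

Lemma all_owned_in_branch p v s :
  all (owned p) s -> all (owned p) (pmap (in_branch v) s).
Proof.
elim: s => //= -[q a] s IHs /andP[oq /IHs all_s]; rewrite /in_branch /=.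
by case: strip => //= b; rewrite all_s andbT.
Qed.

(** The last move of [rcons s (p, a)] is either malformed, hence malformed in [G] too, or an offence
    in some branch, which [illegal_by_delay] carries over. Which player offends first in [G] is left
    open here. *)
Lemma RL_illegal_cut (A : game) p D G n s a :
  static A -> delay p D G -> iprefix n D = rcons s (p, a) ->
  RL_lr A (Fin s) -> ~ RL_lr A (Fin (rcons s (p, a))) ->
  exists th t, [/\ exists k, iprefix k G = rcons th (p, a),
    ~ RL_lr A (Fin (rcons th (p, a))) &
    delay p (Fin (rcons s (p, a))) (Fin (rcons th (p, a) ++ t))].
Proof.
move=> hA del En [form_s leg_s] ill.
have [th [t [Gth all_t del1]]] := delay_cut del En.
exists th, t; split=> // -[form_th leg_th]; apply: ill; split=> [i lm|v].
  rewrite /= -cats1 onth_cat; case: ltnP => _; first exact: form_s.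
  case: (i - size s) => [[<-]|j]; last by rewrite onth_default.
  by apply: (form_th (size th)); rewrite /= -cats1 onth_cat ltnn subnn.
apply: contrapT => ill_v.
have := leg_s v; have := leg_th v; move: ill_v (delay_branch v del1).
rewrite !branch_Fin -cats1 !pmap_cat /=.
(* A move outside the branch [v] leaves that branch as legal as before. *)
case E: (in_branch v (p, a)) => [[q b]|] /=; last by rewrite cats0.
have -> : q = p by move: E; rewrite /in_branch /=; case: strip => //= c [].
rewrite !cats1 => ill_v delv leg_v leg_sv.
have := illegal_by_rcons_cat [::] leg_sv ill_v; rewrite cats0.
move=> /(illegal_by_delay hA delv) illt.
apply: (@illegal_by_not_lr A p (Fin _) _ leg_v).
apply: illegal_by_Fin_cat (all_owned_in_branch v all_t) illt => /=.
exact: take_size.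
Qed.

Lemma RL_illegal_by_delay (A : game) p D G :
  static A -> delay p D G -> illegal_by (RL A) p D -> illegal_by (RL A) p G.
Proof.
move=> hA del /illegal_byP [n [s [a [En leg ill]]]].
have [th [t [[k Ek] ill_th del1]]] := RL_illegal_cut hA del En leg ill.
have leg0 : RL_lr A (Fin [::]).
  by apply: (@lr_initial (RL A) _ 0 _ [::] leg); rewrite /= take0.
have [q] := @not_lr_illegal_by (RL A) _ leg0 ill_th.
have [->|Nq] := eqVneq q p.
  by move=> ?; apply: (illegal_by_Fin_cat Ek (t := [::])); rewrite ?cats0.
have {q Nq} -> : q = opp p by move: Nq; case: (q); case: (p).
move=> /illegal_byP [m [u [b [Em leg_u ill_u]]]].
(* An earlier offence of the adversary in [G] would in turn come with an
   offence of the adversary in [D], before that of [p]. *)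
have [m' Em'] : exists m',
    iprefix m' (Fin (rcons th (p, a) ++ t)) = rcons u (opp p, b).
  have [m' Em'] := iprefix_iprefix (Fin (rcons th (p, a) ++ t)) m
                     (size (rcons th (p, a))).
  by exists m'; rewrite -Em' -Em /= take_size_cat.
have [th' [t' [[l El] ill' _]]] :=
  RL_illegal_cut hA (delay_sym del1) Em' leg_u ill_u.
(* This illegal prefix ends with a move of [opp p], so it stops short of [(p, a)] and lies within
   the legal [s]. *)
case: ill'; rewrite -El /=; have [lel|ltl] := leqP l (size s).
  rewrite -cats1 takel_cat //.
  apply: (@lr_initial (RL A) (Fin s) (size s) _ (drop l s)) => //.
  by rewrite /= take_size cat_take_drop.
move: El; rewrite /= take_oversize ?size_rcons // => /rcons_inj [_ Ep].
by move: Ep; case: (p).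
Qed.

(** All switch moves are made by [Bot], so a delay keeps their order and the same branch decides
    both runs. *)
Lemma RL_bot_won_delay (A : game) D G :
  static A -> delay Bot D G -> RL_bot_won A G -> RL_bot_won A D.
Proof.
move=> hA del; have [movesE _] := del.
rewrite /RL_bot_won (switches_moves_of (movesE Bot)); case: switches => // ws.
by move/hA; apply; apply: delay_branch.
Qed.

Lemma static_RL (A : game) : static A -> static (RL A).
Proof.
move=> hA p G D [[leg winG]|ill] del; last first.
  by right; apply: RL_illegal_by_delay hA (delay_sym del) ill.
have [legD|illD] := pselect (RL_lr A D); [left | right].
  (* [Top] wins a legal run when [Bot] does not, so its case is the contrapositive along the
     reversed delay. *)
  split=> //; move: winG => /=; case: p del => del.
    case: asboolP => // NG _; case: asboolP => // winD; case: NG.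
    exact: RL_bot_won_delay hA (delay_sym del) winD.
  by case: asboolP => // winG _; case: asboolP => // -[]; apply: RL_bot_won_delay winG.
have leg0 : RL_lr A (Fin [::]).
  by apply: (@lr_initial (RL A) _ 0 _ [::] leg); case: (G) => [s|g]; rewrite /= ?take0.
have [q illq] := @not_lr_illegal_by (RL A) _ leg0 illD.
(* An offence of [p] in [D] would come from one in the legal run [G]. *)
have [Eq|Nq] := eqVneq q p.
  by rewrite Eq in illq; case: (illegal_by_not_lr (RL_illegal_by_delay hA del illq)).
by move: Nq illq; case: (q); case: (p).
Qed.

(** * Negation and the corecurrence *)

Lemma illegal_by_neg (A : game) p G :
  illegal_by (neg A) p G <-> illegal_by A (opp p) (imap flip_label G).
Proof.
split=> -[n [ill min [s [a E]]]]; exists n.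
  split=> [|m /min|]; rewrite ?iprefix_imap //.
  by exists (map flip_label s), a; rewrite E map_rcons.
rewrite iprefix_imap in ill E.
split=> // [m /min|]; first by rewrite iprefix_imap.
case: (lastP (iprefix n G)) E => [|s' [q b]]; first by case: s.
by rewrite map_rcons => /rcons_inj [_ /negb_inj -> _]; exists s', b.
Qed.

Lemma won_neg (A : game) p G :
  won (neg A) p G <-> won A (opp p) (imap flip_label G).
Proof.
rewrite /won illegal_by_neg /=.
split=> -[[leg win]|ill]; [left | by right | left | by right]; split=> //.
  by rewrite -win negbK.
by rewrite win negbK.
Qed.

Lemma static_neg (A : game) : static A -> static (neg A).
Proof.
move=> hA p G D /won_neg winG del; apply/won_neg.
exact: hA winG (delay_flip del).
Qed.

Theorem theorem5p1 (A : game) (hA : static A) : static (RL A) /\ static (CL A).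
Proof.
by split; [| apply: static_neg]; apply: static_RL => //; apply: static_neg.
Qed.
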